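(* Let $(\mathcal N,\mathcal M,(v_i)_{i\in\mathcal N},(b_i)_{i\in\mathcal N})$ be a fair division instance with $\mathcal N=[n]$, $\mathcal M=[m]$, monotone valuations $v_i:2^{\mathcal M}\to\mathbb R_{\ge0}$, and entitlements $b_i>0$ with $\sum_i b_i=1$. For each $i$ let $\widehat v_i:\mathbb{R}^m\to\mathbb R_{+}$ be a non-negative, non-decreasing continuous extension of $v_i$ (i.e. $\widehat v_i(\mathbf 1_S)=v_i(S)$ for all $S\subseteq\mathcal M$), and let $(\mathbf x^*,\mathbf p^* )$ be a market equilibrium for the valuations $\widehat v_i$ and budgets $b_i$. Then $\mathsf{APS}_i\le\widehat v_i(\mathbf x_i^* )$ for all $i\in\mathcal N$.
   Context: A market equilibrium consists of prices $\mathbf p^*=(p_j)_{j\in\mathcal M}$, $p_j\ge 0$, and a fractional allocation $\mathbf x^*=(x_{ij})_{i\in\mathcal N,j\in\mathcal M}$, $x_{ij}\ge0$, such that: (1) for each agent $i$, $\mathbf x^*_i=(x_{i1},\dots,x_{im})\in\arg\max\{\widehat v_i(y): y\in\mathbb R_{\ge 0}^m,\ \sum_j y_jp_j\le b_i\}$; (2) for each good $j$, either $\sum_{i}x_{ij}=1$, or $\sum_i x_{ij}<1$ and $p_j=0$. Any price share: $\mathsf{APS}_i=\min_{p}\max_{S\subseteq\mathcal M:\ \sum_{j\in S}p_j\le b_i}v_i(S)$, the minimum over $p\in\mathbb R_{\ge0}^m$ with $\sum_jp_j=1$. *)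

(* Defs.v *)
From mathcomp Require Import all_boot all_order all_algebra.
From mathcomp Require Import all_classical all_reals all_analysis.

Set Implicit Arguments.
Unset Strict Implicit.
Unset Printing Implicit Defensive.

Import Order.TTheory GRing.Theory Num.Theory.
Import numFieldNormedType.Exports.
Local Open Scope classical_set_scope.
Local Open Scope ring_scope.

Definition is_fair_division_instance (R : realType) (n m : nat)
    (v : 'I_n -> {set 'I_m} -> R) (b : 'I_n -> R) : Prop :=
  [/\ forall i S, 0 <= v i S,
      forall i (S T : {set 'I_m}), S \subset T -> v i S <= v i T,
      forall i, 0 < b i
    & \sum_(i < n) b i = 1].

Definition indicator_vector (R : realType) (m : nat) (S : {set 'I_m}) :
    'rV[R]_m :=
  \row_j (j \in S)%:R.

Definition is_continuous_extension (R : realType) (m : nat)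
    (v : {set 'I_m} -> R) (vhat : 'rV[R]_m -> R) : Prop :=
  [/\ forall y, 0 <= vhat y,
      forall y z : 'rV[R]_m, (forall j, y 0 j <= z 0 j) -> vhat y <= vhat z,
      continuous vhat
    & forall S : {set 'I_m}, vhat (indicator_vector R S) = v S].

Definition budget_set (R : realType) (m : nat) (p : 'rV[R]_m) (b : R) :
    set 'rV[R]_m :=
  [set y | (forall j, 0 <= y 0 j) /\ \sum_(j < m) y 0 j * p 0 j <= b].

Definition argmax (R : realType) (T : Type) (f : T -> R) (A : set T) : set T :=
  [set x | A x /\ forall y, A y -> f y <= f x].

Definition market_equilibrium (R : realType) (n m : nat)
    (vhat : 'I_n -> 'rV[R]_m -> R) (b : 'I_n -> R)
    (x : 'M[R]_(n, m)) (p : 'rV[R]_m) : Prop :=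
  [/\ forall j, 0 <= p 0 j,
      forall i j, 0 <= x i j,
      forall i, argmax (vhat i) (budget_set p (b i)) (row i x)
    & forall j, \sum_(i < n) x i j = 1 \/
                (\sum_(i < n) x i j < 1 /\ p 0 j = 0)].

Definition price_simplex (R : realType) (m : nat) : set 'rV[R]_m :=
  [set p | (forall j, 0 <= p 0 j) /\ \sum_(j < m) p 0 j = 1].

(* The default value [v set0] does not change the maximum: the empty bundle
   costs 0, hence is affordable for every nonnegative budget. *)
Definition max_affordable (R : realType) (m : nat) (v : {set 'I_m} -> R)
    (b : R) (p : 'rV[R]_m) : R :=
  \big[Num.max/v finset.set0]_(S : {set 'I_m} | \sum_(j in S) p 0 j <= b) v S.

(* The infimum is a minimum as soon as there is at least one good, see
   [APS_min]. Without goods the simplex is empty and the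
   value is [inf set0 = 0]. *)
Definition APS (R : realType) (m : nat) (v : {set 'I_m} -> R) (b : R) : R :=
  inf [set max_affordable v b p | p in @price_simplex R m].

Lemma max_affordable_bundle (R : realType) (m : nat) (v : {set 'I_m} -> R)
    (b : R) (p : 'rV[R]_m) : exists S, max_affordable v b p = v S.
Proof.
rewrite /max_affordable; elim/big_ind: _ => [|a c [S ->] [T ->]|S _].
- by exists finset.set0.
- by rewrite /Num.max; case: ifP => _; [exists T | exists S].
- by exists S.
Qed.

Lemma price_simplex_neq0 (R : realType) (m : nat) :
  (0 < m)%N -> @price_simplex R m !=set0.
Proof.
move=> m0; pose k := Ordinal m0; exists (\row_j (j == k)%:R); split.
  by move=> j; rewrite mxE ler0n.
rewrite (bigD1 k) //= mxE eqxx big1 ?addr0 // => j /negPf jk.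
by rewrite mxE jk.
Qed.

Lemma APS_min (R : realType) (m : nat) (v : {set 'I_m} -> R) (b : R) :
  (0 < m)%N ->
  exists2 p, price_simplex p & APS v b = max_affordable v b p /\
    forall q, price_simplex q -> max_affordable v b p <= max_affordable v b q.
Proof.
move=> m0; have [p0 p0P] := price_simplex_neq0 R m0.
pose P S := `[< exists2 p, price_simplex p & max_affordable v b p = v S >].
have [S0 S0E] := max_affordable_bundle v b p0.
have PS0 : P S0 by apply/asboolP; exists p0.
case: (arg_minP v PS0) => S /asboolP[p pP pE] minS.
have pmin q : price_simplex q -> max_affordable v b p <= max_affordable v b q.
  move=> qP; have [T TE] := max_affordable_bundle v b q.
  by rewrite pE TE; apply: minS; apply/asboolP; exists q.
exists p => //; split=> //; apply/eqP; rewrite eq_le; apply/andP; split.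
  apply: ge_inf; last by exists p.
  by exists (max_affordable v b p) => _ [q qP <-]; exact: pmin.
apply: lb_le_inf; first by exists (max_affordable v b p), p.
by move=> _ [q qP <-]; exact: pmin.
Qed.

(* Main.v *)
(* Market clearing and the budget constraints bound the total equilibrium price
   by 1. Raising the price of a single good to make the total exactly 1 gives a
   point of the price simplex dominating the equilibrium prices, so every bundle
   affordable there is affordable at equilibrium, hence worth at most the
   equilibrium allocation. *)
Require Import Defs.
From mathcomp Require Import all_boot all_order all_algebra.
From mathcomp Require Import all_classical all_reals all_analysis.

Set Implicit Arguments.
Unset Strict Implicit.
Unset Printing Implicit Defensive.

Import Order.TTheory GRing.Theory Num.Theory.
Import numFieldNormedType.Exports.
Local Open Scope classical_set_scope.
Local Open Scope ring_scope.

Lemma max_affordable_le (R : realType) (m : nat) (v : {set 'I_m} -> R)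
    (b : R) (p : 'rV[R]_m) (c : R) :
  0 <= b ->
  (forall S : {set 'I_m}, \sum_(j in S) p 0 j <= b -> v S <= c) ->
  max_affordable v b p <= c.
Proof.
move=> b0 vc; rewrite /max_affordable.
apply: (big_ind (fun y => y <= c)) => [|y z yc zc|]; last exact: vc.
(* The default value of the maximum is the value of the empty bundle, whose cost 0 is within the
   budget by [0 <= b]. *)
- by apply: vc; rewrite big_set0.
- by rewrite ge_max yc.
Qed.

Lemma APS_le_max_affordable (R : realType) (m : nat) (v : {set 'I_m} -> R)
    (b : R) (p : 'rV[R]_m) :
  (0 < m)%N -> price_simplex p -> APS v b <= max_affordable v b p.
Proof. by move=> m0 pP; have [q _ [-> ->]] := APS_min v b m0. Qed.

(** An empty sum of prices cannot equal 1, so the infimum is over the empty set, where [inf] is 0 by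
    convention. *)
Lemma APS_no_goods (R : realType) (v : {set 'I_0} -> R) (b : R) : APS v b = 0.
Proof.
rewrite /APS; suff -> : @price_simplex R 0 = classical_sets.set0.
  by rewrite image_set0 inf0.
rewrite -subset0 => p [_]; rewrite big_ord0 => /eqP.
by rewrite eq_sym oner_eq0.
Qed.

Lemma price_simplex_dominating (R : realType) (m : nat) (p : 'rV[R]_m) :
  (0 < m)%N -> (forall j, 0 <= p 0 j) -> \sum_(j < m) p 0 j <= 1 ->
  exists2 q, price_simplex q & forall j, p 0 j <= q 0 j.
Proof.
move=> m0 p0 p1; pose k := Ordinal m0.
pose r := 1 - \sum_(j < m) p 0 j.
have r0 : 0 <= r by rewrite subr_ge0.
(* The whole deficit [r] is added to the price of good [k]. *)
exists (p + r *: delta_mx 0 k); last first.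
  by move=> j; rewrite !mxE lerDl mulr_ge0.
split=> [j|]; first by rewrite !mxE addr_ge0 ?mulr_ge0.
under eq_bigr do rewrite !mxE eqxx /=.
rewrite big_split /= -mulr_sumr.
rewrite (_ : \sum_(j < m) (j == k)%:R = 1) ?mulr1 1?addrC ?subrK //.
by rewrite (bigD1 k) //= big1 ?addr0 // => j /negPf ->.
Qed.

(** A good that is not sold out is free, so the total price equals the total spending of the agents,
    each of whom stays within budget. *)
Lemma market_equilibrium_price_sum (R : realType) (n m : nat)
    (vhat : 'I_n -> 'rV[R]_m -> R) (b : 'I_n -> R)
    (x : 'M[R]_(n, m)) (p : 'rV[R]_m) :
  market_equilibrium vhat b x p ->
  \sum_(j < m) p 0 j <= \sum_(i < n) b i.
Proof.
case=> _ _ opt clear.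
have -> : \sum_(j < m) p 0 j = \sum_(i < n) \sum_(j < m) x i j * p 0 j.
  rewrite exchange_big /=; apply: eq_bigr => j _; rewrite -mulr_suml.
  by case: (clear j) => [->|[_ ->]]; rewrite ?mul1r ?mulr0.
apply: ler_sum => i _; have [[_ ]] := opt i.
by under eq_bigr do rewrite mxE.
Qed.

Lemma indicator_vector_affordable (R : realType) (m : nat) (p : 'rV[R]_m)
    (b : R) (S : {set 'I_m}) :
  \sum_(j in S) p 0 j <= b -> budget_set p b (indicator_vector R S).
Proof.
move=> Sb; split=> [j|]; first by rewrite mxE ler0n.
apply: le_trans Sb; rewrite [leRHS]big_mkcond /=; apply: ler_sum => j _.
by rewrite mxE; case: ifP; rewrite ?mul1r ?mul0r.
Qed.

Theorem lemma3p1 (R : realType) (n m : nat)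
    (v : 'I_n -> {set 'I_m} -> R) (b : 'I_n -> R)
    (vhat : 'I_n -> 'rV[R]_m -> R) (x : 'M[R]_(n, m)) (p : 'rV[R]_m) :
  is_fair_division_instance v b ->
  (forall i, is_continuous_extension (v i) (vhat i)) ->
  market_equilibrium vhat b x p ->
  forall i, APS (v i) (b i) <= vhat i (row i x).
Proof.
case=> _ _ b_gt0 b1 ext eqm i; have [vhat0 _ _ vhatE] := ext i.
have [m0|m_gt0] := posnP m.
  (* Here the share is 0, and [vhat i] is nonnegative. *)
  by subst m; rewrite APS_no_goods.
have [p0 _ opt _] := eqm.
have p1 : \sum_(j < m) p 0 j <= 1.
  by rewrite -b1; exact: market_equilibrium_price_sum eqm.
have [q qP pq] := price_simplex_dominating m_gt0 p0 p1.
apply: le_trans (APS_le_max_affordable _ _ m_gt0 qP) _.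
apply: max_affordable_le => [|S Sb]; first exact: ltW.
(* The indicator vector of [S] competes with [row i x] in the argmax once it is affordable at [p];
   this follows from affordability of [S] at the higher prices [q]. *)
rewrite -vhatE; have [_] := opt i; apply.
apply: indicator_vector_affordable; apply: le_trans Sb.
by apply: ler_sum => j _; exact: pq.
Qed.
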